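(* A locally optimal solution to the bipartite boolean quadratic programming problem (BBQP) with respect to the neighborhood $\mathbb{N}^{\alpha}=\mathbb{N}^{m\alpha}\cup\mathbb{N}^{\alpha n}$ could be worse than average for any $\alpha\le\lfloor n/5\rfloor$. That is, for every positive integer $n$ and every integer $\alpha$ with $0\le\alpha\le\lfloor n/5\rfloor$, there exist $m\le n$, a BBQP instance $(Q,c,d)$ with $Q$ a real $m\times n$ matrix, and a solution $(x^0,y^0)$ that is locally optimal with respect to $\mathbb{N}^{\alpha}$ and satisfies $f(x^0,y^0)<\mathcal{A}(Q,c,d)$.
   Context: A BBQP instance is given by a real $m\times n$ matrix $Q$ and row vectors $c\in\mathbb{R}^m$, $d\in\mathbb{R}^n$ (with $m\le n$); the problem is to maximize $f(x,y)=x^TQy+cx+dy$ over $\mathcal{F}=\{0,1\}^m\times\{0,1\}^n$. The average value of all solutions is $\mathcal{A}(Q,c,d)=2^{-(m+n)}\sum_{(x,y)\in\mathcal{F}}f(x,y)$. For $(x^0,y^0)\in\mathcal{F}$ and nonnegative integers $h,k$, the neighborhood $\mathbb{N}^{hk}$ of $(x^0,y^0)$ is the set of all solutions in $\mathcal{F}$ obtained by flipping at most $h$ components of $x^0$ and at most $k$ components of $y^0$. Thus $\mathbb{N}^{m\alpha}$ allows any change of $x^0$ and at most $\alpha$ flips in $y^0$, and $\mathbb{N}^{\alpha n}$ allows at most $\alpha$ flips in $x^0$ and any change of $y^0$. Set $\mathbb{N}^{\alpha}=\mathbb{N}^{m\alpha}\cup\mathbb{N}^{\alpha n}$. A solution $(x^0,y^0)$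 is locally optimal with respect to a neighborhood if $f(x,y)\le f(x^0,y^0)$ for every $(x,y)$ in that neighborhood of $(x^0,y^0)$. *)

(* Defs.v *)
From mathcomp Require Import all_boot all_order all_algebra.
From mathcomp Require Import reals.

Set Implicit Arguments.
Unset Strict Implicit.
Unset Printing Implicit Defensive.

Import Order.TTheory GRing.Theory Num.Theory.

Local Open Scope ring_scope.

(* Feasible set {0,1}^m x {0,1}^n: a notation, so that the finType structure
   of the product of boolean matrices is found directly. *)
Notation solution m n := ('cV[bool]_m * 'cV[bool]_n)%type.

Definition real_vec (R : realType) (k : nat) (x : 'cV[bool]_k) : 'cV[R]_k :=
  map_mx (fun b : bool => b%:R) x.

(* x^T Q y + c x + d y, read off as the entry of a 1 x 1 matrix. *)
Definition bbqp_value (R : realType) (m n : nat)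
    (Q : 'M[R]_(m, n)) (c : 'rV[R]_m) (d : 'rV[R]_n) (s : solution m n) : R :=
  let x := real_vec R s.1 in
  let y := real_vec R s.2 in
  (x^T *m Q *m y + c *m x + d *m y) 0 0.

Definition bbqp_average (R : realType) (m n : nat)
    (Q : 'M[R]_(m, n)) (c : 'rV[R]_m) (d : 'rV[R]_n) : R :=
  (2 ^+ (m + n))^-1 * \sum_(s : solution m n) bbqp_value Q c d s.

Definition flips (k : nat) (x0 x : 'cV[bool]_k) : nat :=
  #|[set i | x i 0 != x0 i 0]|.

Definition nbhd_hk (m n h k : nat) (s0 : solution m n) : {set solution m n} :=
  [set s | (flips s0.1 s.1 <= h)%N && (flips s0.2 s.2 <= k)%N].

Definition nbhd_alpha (m n alpha : nat) (s0 : solution m n) :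
    {set solution m n} :=
  nbhd_hk m alpha s0 :|: nbhd_hk alpha n s0.

Definition locally_optimal (R : realType) (m n : nat)
    (Q : 'M[R]_(m, n)) (c : 'rV[R]_m) (d : 'rV[R]_n)
    (N : solution m n -> {set solution m n}) (s0 : solution m n) : Prop :=
  forall s, s \in N s0 -> bbqp_value Q c d s <= bbqp_value Q c d s0.

(* Main.v *)
Require Import Defs.
From mathcomp Require Import all_boot all_order all_algebra.
From mathcomp Require Import reals.
From mathcomp Require Import ring zify.

(** The counterexample is square ([m = n]) and symmetric under permuting the
    coordinates of [x] and of [y].  With [p] and [q] the numbers of ones in [x]
    and [y], take
      [f(x,y) = a p q - b (p + q)],  [a = alpha + n],  [b = alpha n],
    and the solution [(0,0)], of value [0].  The reward [a p q] is earned only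
    when both vectors move far away from [0]; the linear penalty [b] is chosen
    so that it exactly cancels the reward at the corner [p = alpha, q = n] of
    the neighborhood.  Local optimality is the identity
      [f = alpha p (q - n) + n q (p - alpha)],
    both terms of which are nonpositive for [p <= alpha], [q <= n]; the other
    half of the neighborhood follows by exchanging [p] and [q]
    (lemma [penalized_product_le0]).

    On average [p] and [q] are [n / 2], and they vary independently, so that
    the average of [f] is [a n^2 / 4 - b n = n^2 (n - 3 alpha) / 4] (lemma
    [bbqp_average_const]).  This is positive as soon as [3 alpha < n], in
    particular for [alpha <= n / 5] with [n] positive. *)

Set Implicit Arguments.
Unset Strict Implicit.
Unset Printing Implicit Defensive.

Import Order.TTheory GRing.Theory Num.Theory.

Local Open Scope ring_scope.

Definition weight (k : nat) (x : 'cV[bool]_k) : nat := (\sum_(i < k) x i 0%R)%N.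

Lemma flips_from_zero (k : nat) (x : 'cV[bool]_k) :
  flips (const_mx false) x = weight x.
Proof.
rewrite /flips /weight -sum1dep_card big_mkcond /=.
by apply: eq_bigr => i _; rewrite mxE; case: (x i 0).
Qed.

Lemma const_mx_mul_real_vec (R : realType) (l k : nat) (a : R)
    (x : 'cV[bool]_k) :
  const_mx a *m real_vec R x = const_mx (a * (weight x)%:R) :> 'cV[R]_l.
Proof.
apply/matrixP => i j; rewrite ord1 !mxE natr_sum mulr_sumr.
by apply: eq_bigr => r _; rewrite !mxE.
Qed.

Lemma bbqp_value_const (R : realType) (m n : nat) (a b c : R)
    (s : solution m n) :
  bbqp_value (const_mx a) (const_mx b) (const_mx c) s =
  a * (weight s.1)%:R * (weight s.2)%:R
    + b * (weight s.1)%:R + c * (weight s.2)%:R.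
Proof.
rewrite /bbqp_value -mulmxA !const_mx_mul_real_vec !mxE; congr (_ + _ + _).
transitivity (\sum_(i < m) (s.1 i 0)%:R * (a * (weight s.2)%:R)).
  by apply: eq_bigr => i _; rewrite !mxE.
by rewrite -mulr_suml -natr_sum mulrC mulrAC.
Qed.

Definition complement (k : nat) (x : 'cV[bool]_k) : 'cV[bool]_k :=
  map_mx negb x.

Lemma complementK (k : nat) : involutive (@complement k).
Proof. by move=> x; apply/matrixP => i j; rewrite !mxE negbK. Qed.

Lemma weight_complement (k : nat) (x : 'cV[bool]_k) :
  (weight x + weight (complement x) = k)%N.
Proof.
rewrite /weight -big_split /= -[RHS]card_ord -sum1_card.
by apply: eq_bigr => i _; rewrite mxE; case: (x i 0).
Qed.

Lemma sum_const_cV (R : realType) (k : nat) (a : R) :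
  \sum_(x : 'cV[bool]_k) a = 2 ^+ k * a.
Proof. by rewrite sumr_const card_mx card_bool muln1 -[LHS]mulr_natl natrX. Qed.

(** Pairing each vector with its complement shows that the mean weight is
    [k / 2]. *)
Lemma sum_weight (R : realType) (k : nat) :
  \sum_(x : 'cV[bool]_k) (weight x)%:R = 2 ^+ k * (k%:R / 2) :> R.
Proof.
set S := LHS.
have E : S + S = 2 ^+ k * k%:R.
  rewrite {2}/S (reindex_inj (inv_inj (@complementK k))) -big_split /=.
  under eq_bigr => x _ do rewrite -natrD weight_complement.
  exact: sum_const_cV.
by rewrite mulrA -E; field.
Qed.

(** The value depends on [x] and [y] only through their weights and is affine in
    each weight; as [x] and [y] vary independently, the average is the value at
    the mean weights [m / 2] and [n / 2]. *)
Lemma bbqp_average_const (R : realType) (m n : nat) (a b c : R) :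
  bbqp_average (const_mx a : 'M_(m, n)) (const_mx b) (const_mx c) =
  a * (m%:R / 2) * (n%:R / 2) + b * (m%:R / 2) + c * (n%:R / 2).
Proof.
rewrite /bbqp_average.
under eq_bigr => s _ do rewrite bbqp_value_const.
rewrite -(pair_bigA _ (fun (x : 'cV[bool]_m) (y : 'cV[bool]_n) =>
  a * (weight x)%:R * (weight y)%:R
    + b * (weight x)%:R + c * (weight y)%:R)) /=.
under eq_bigr => x _.
  rewrite !big_split /= -!mulr_sumr sum_weight !sum_const_cV; over.
rewrite /= !big_split /= -!mulr_sumr -!mulr_suml -!mulr_sumr.
rewrite !sum_weight !sum_const_cV exprD.
by field; rewrite !expf_neq0 ?pnatr_eq0.
Qed.

(** The coefficients are chosen so that the expression vanishes at the corner
    [p = alpha, q = n] of the box; what is left has a fixed sign on the box. *)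
Lemma penalized_product_le0 (R : realType) (alpha n p q : R) :
    0 <= alpha -> 0 <= n -> 0 <= p <= alpha -> 0 <= q <= n ->
  (alpha + n) * p * q - alpha * n * p - alpha * n * q <= 0.
Proof.
move=> alpha0 n0 /andP[p0 p_le] /andP[q0 q_le].
have -> : (alpha + n) * p * q - alpha * n * p - alpha * n * q =
    - (alpha * p * (n - q) + n * q * (alpha - p)) by ring.
by rewrite oppr_le0 addr_ge0 // !mulr_ge0 // subr_ge0.
Qed.

Theorem theorem7 (R : realType) (n alpha : nat)
    (n_gt0 : (0 < n)%N) (alpha_le : (alpha <= n %/ 5)%N) :
  exists m : nat, (0 < m <= n)%N /\
  exists (Q : 'M[R]_(m, n)) (c : 'rV[R]_m) (d : 'rV[R]_n) (s0 : solution m n),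
    locally_optimal Q c d (nbhd_alpha alpha) s0 /\
    bbqp_value Q c d s0 < bbqp_average Q c d.
Proof.
exists n; split; first by rewrite n_gt0 leqnn.
pose b : R := - (alpha%:R * n%:R).
pose s0 : solution n n := (const_mx false, const_mx false).
exists (const_mx (alpha%:R + n%:R)), (const_mx b), (const_mx b), s0.
have weight_s0 : weight (const_mx false : 'cV[bool]_n) = 0%N.
  by rewrite /weight big1 // => i _; rewrite mxE.
have value_s0 : bbqp_value (const_mx (alpha%:R + n%:R)) (const_mx b)
    (const_mx b) s0 = 0 by rewrite bbqp_value_const /= weight_s0; ring.
rewrite /locally_optimal value_s0; split=> [[x y]|].
  rewrite !inE /= !flips_from_zero bbqp_value_const /= /b !mulNr.
  case/orP=> /andP[hx hy].
    (* Here [y], not [x], is confined to few flips: exchange their roles. *)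
    rewrite mulrAC addrAC.
    by apply: penalized_product_le0; rewrite ?ler0n ?ler_nat.
  by apply: penalized_product_le0; rewrite ?ler0n ?ler_nat.
rewrite bbqp_average_const.
have -> : (alpha%:R + n%:R) * (n%:R / 2) * (n%:R / 2) + b * (n%:R / 2)
    + b * (n%:R / 2) = n%:R ^+ 2 * (n%:R - 3 * alpha%:R) / 4 :> R.
  by rewrite /b; field.
have alpha_lt : (3 * alpha < n)%N by lia.
rewrite divr_gt0 ?mulr_gt0 ?exprn_gt0 ?ltr0n //.
by rewrite subr_gt0 -natrM ltr_nat.
Qed.
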